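(* For every $\boldsymbol{x}\in\mathcal{X}^n$ it holds that $\mu(\boldsymbol{x})=\bigl(1-\|I-G^{\boldsymbol{x}}\|_2\bigr)^{-1/2}$ and $$\min\{2(1-\mu(\boldsymbol{x})^{-2}),1\}\le\tau(\boldsymbol{x})\le\min\{(1+\sqrt{d})(1-\mu(\boldsymbol{x})^{-2}),1\}.$$
   Context: $\mathcal{V}$ is a real reproducing kernel Hilbert space of functions on a set $\mathcal{X}$ with inner product $(\cdot,\cdot)_{\mathcal{V}}$, norm $\|\cdot\|_{\mathcal{V}}$ and reproducing kernel $k$. $\mathcal{V}_d\subseteq\mathcal{V}$ is a fixed $d$-dimensional subspace with $\mathcal{V}$-orthonormal basis $b_1,\dots,b_d$. For $\boldsymbol{x}=(x_1,\dots,x_n)\in\mathcal{X}^n$ put $\mathcal{V}_{\boldsymbol{x}}:=\operatorname{span}\{k(x_1,\cdot),\dots,k(x_n,\cdot)\}$, let $P_{\mathcal{V}_{\boldsymbol{x}}}$ be the $\mathcal{V}$-orthogonal projection onto it, and put $(v,w)_{\boldsymbol{x}}:=(P_{\mathcal{V}_{\boldsymbol{x}}}v,w)_{\mathcal{V}}$, $\|v\|_{\boldsymbol{x}}:=\|P_{\mathcal{V}_{\boldsymbol{x}}}v\|_{\mathcal{V}}$. Define $\mu(\boldsymbol{x}):=\max_{0\ne v\in\mathcal{V}_d}\|v\|_{\mathcal{V}}/\|v\|_{\boldsymbol{x}}\in(0,\infty]$ (equal to $\infty$ if some nonzero $v\in\mathcal{V}_d$ has $\|v\|_{\boldsymbol{x}}=0$),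 $G^{\boldsymbol{x}}\in\mathbb{R}^{d\times d}$ by $G^{\boldsymbol{x}}_{jk}:=(b_j,b_k)_{\boldsymbol{x}}$, and $\tau(\boldsymbol{x}):=\min\{\|I-G^{\boldsymbol{x}}\|_{\mathrm{Fro}}+\|I-G^{\boldsymbol{x}}\|_2,1\}$, with Frobenius norm $\|\cdot\|_{\mathrm{Fro}}$ and spectral norm $\|\cdot\|_2$. Conventions: $0^{-1/2}=\infty$, $\infty^{-2}=0$. *)

(* Defs.v *)
From HB Require Import structures.
From mathcomp Require Export all_boot all_order all_algebra sesquilinear.
From mathcomp Require Export all_classical all_reals.
From mathcomp Require Export topology normedtype.

Set Implicit Arguments.
Unset Strict Implicit.
Unset Printing Implicit Defensive.

Import Order.TTheory GRing.Theory Num.Theory.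
Import numFieldNormedType.Exports.

Local Open Scope classical_set_scope.
Local Open Scope ring_scope.

(* The elements of the space are identified with functions on X through the
   linear injection [feval]; [ksec x] is the element k(x, .). *)
Record rkhs (R : realType) (X : Type) := RKHS {
  rkhs_space :> completeNormedModType R;
  inner : {dot rkhs_space for idfun};
  normr_inner : forall v : rkhs_space, `|v| ^+ 2 = inner v v;
  feval : rkhs_space -> X -> R;
  feval_linear : forall (a : R) (v w : rkhs_space) (x : X),
    feval (a *: v + w) x = a * feval v x + feval w x;
  feval_inj : forall v w : rkhs_space, feval v =1 feval w -> v = w;
  kernel : X -> X -> R;
  ksec : X -> rkhs_space;
  ksecE : forall x y : X, feval (ksec x) y = kernel x y;
  reproducing : forall (v : rkhs_space) (x : X), inner v (ksec x) = feval v x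
}.

Definition lin_span (R : realType) (V : lmodType R) (m : nat) (u : 'I_m -> V) :
    set V :=
  [set \sum_(i < m) c i *: u i | c in [set: 'I_m -> R]].

Definition orthonormal_basis (R : realType) (X : Type) (V : rkhs R X) (d : nat)
    (b : 'I_d -> V) (W : set V) : Prop :=
  (forall i j : 'I_d, inner V (b i) (b j) = (i == j)%:R) /\ W = lin_span b.

(* The unique w in W with v - w orthogonal to W; it exists whenever W is a
   finite-dimensional subspace, so the default value 0 of [xget] is then not
   used. *)
Definition orth_proj (R : realType) (X : Type) (V : rkhs R X) (W : set V)
    (v : V) : V :=
  xget 0 [set w | W w /\ forall u : V, W u -> inner V (v - w) u = 0].

Definition Vx (R : realType) (X : Type) (V : rkhs R X) (n : nat)
    (x : 'I_n -> X) : set V :=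
  lin_span (fun i => ksec V (x i)).
Arguments Vx {R X} V {n} x _.

Definition inner_x (R : realType) (X : Type) (V : rkhs R X) (n : nat)
    (x : 'I_n -> X) (v w : V) : R :=
  inner V (orth_proj (Vx V x) v) w.

Definition norm_x (R : realType) (X : Type) (V : rkhs R X) (n : nat)
    (x : 'I_n -> X) (v : V) : R :=
  `|orth_proj (Vx V x) v|.

(* Maximum, not supremum: the value is -oo when S has no greatest element. *)
Definition max_set (R : realType) (S : set (\bar R)) : \bar R :=
  xget -oo%E [set m | S m /\ ubound S m].

(* In \bar R, r / 0 = +oo for 0 < r. *)
Definition mu (R : realType) (X : Type) (V : rkhs R X) (Vd : set V) (n : nat)
    (x : 'I_n -> X) : \bar R :=
  max_set [set (`|v|%:E / (norm_x x v)%:E)%E | v in [set v | Vd v /\ v != 0]].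

Definition gram (R : realType) (X : Type) (V : rkhs R X) (d : nat)
    (b : 'I_d -> V) (n : nat) (x : 'I_n -> X) : 'M[R]_d :=
  \matrix_(j, k) inner_x x (b j) (b k).

Definition fro_norm (R : realType) (m n : nat) (A : 'M[R]_(m, n)) : R :=
  Num.sqrt (\sum_(i < m) \sum_(j < n) A i j ^+ 2).

(* Operator norm for the Euclidean norm, which on column vectors is [fro_norm]. *)
Definition spec_norm (R : realType) (m n : nat) (A : 'M[R]_(m, n)) : R :=
  sup [set fro_norm (A *m u) | u in [set u : 'cV[R]_n | fro_norm u <= 1]].

Definition tau (R : realType) (X : Type) (V : rkhs R X) (d : nat)
    (b : 'I_d -> V) (n : nat) (x : 'I_n -> X) : R :=
  Num.min (fro_norm (1%:M - gram b x) + spec_norm (1%:M - gram b x)) 1.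

(* Main.v *)
Require Import Defs.
From mathcomp Require Import ring lra.
Set Implicit Arguments.
Unset Strict Implicit.
Unset Printing Implicit Defensive.

Import Order.TTheory GRing.Theory Num.Theory.
Local Open Scope classical_set_scope.
Local Open Scope ring_scope.

(** Let [A = I - G].  For [v = \sum_i c_i b_i] in [Vd], orthonormality of [b]
    gives [|v|^2 = c^T c], and Pythagoras gives
    [c^T A c = |v|^2 - |P v|^2 = |v - P v|^2], so [A] is symmetric positive
    semidefinite and [A <= I]; in particular [|A|_2 <= 1].  For such a matrix
    [|A|_2] is the largest value of the Rayleigh quotient
    [c^T A c / c^T c = 1 - |P v|^2 / |v|^2], and this value is attained.  Hence
    the minimum of [|P v| / |v|] over the nonzero vectors of [Vd] is
    [sqrt (1 - |A|_2)], which is the formula for [mu]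
    ([mu_orthonormal_basis]).  It follows that [1 - mu^-2 = |A|_2], also when
    [mu] is infinite, and the two bounds on [tau] are
    [|A|_2 <= |A|_Fro <= sqrt d * |A|_2].

    Both properties of the Rayleigh quotient are proved algebraically, from
    [psd_fro_norm_mulmx]: if [A] is positive semidefinite and
    [u^T A u <= c u^T u] for all [u], then [|A u|^2 <= c u^T A u].  This shows
    first that a bound on the Rayleigh quotient bounds the spectral norm
    ([psd_spec_norm_le]).  It also shows that the Rayleigh quotient attains
    [l = |A|_2] ([psd_spec_norm_attained]): [l I - A] is positive semidefinite,
    and if it were invertible, it would be bounded below by a positive
    constant, so that the Rayleigh quotient of [A], and then [|A|_2], would be
    less than [l]; hence [l I - A] has a kernel vector. *)

(** * Euclidean, Frobenius and spectral norms *)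

Definition dotv (R : realType) (m : nat) (u w : 'cV[R]_m) : R :=
  (u^T *m w) 0 0.

Section EuclideanSpace.
Variable R : realType.

Lemma dotvE m (u w : 'cV[R]_m) : dotv u w = \sum_i u i 0 * w i 0.
Proof. by rewrite /dotv mxE; apply: eq_bigr => i _; rewrite mxE. Qed.

Lemma dotvC m (u w : 'cV[R]_m) : dotv u w = dotv w u.
Proof. by rewrite !dotvE; apply: eq_bigr => i _; rewrite mulrC. Qed.

Lemma dotvDr m (u v w : 'cV[R]_m) : dotv u (v + w) = dotv u v + dotv u w.
Proof. by rewrite /dotv mulmxDr mxE. Qed.

Lemma dotvZr m a (u w : 'cV[R]_m) : dotv u (a *: w) = a * dotv u w.
Proof. by rewrite /dotv -scalemxAr mxE. Qed.

Lemma dotv0r m (u : 'cV[R]_m) : dotv u 0 = 0.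
Proof. by rewrite /dotv mulmx0 mxE. Qed.

Lemma dotvNr m (u w : 'cV[R]_m) : dotv u (- w) = - dotv u w.
Proof. by rewrite /dotv mulmxN mxE. Qed.

Lemma dotvDl m (u v w : 'cV[R]_m) : dotv (u + v) w = dotv u w + dotv v w.
Proof. by rewrite dotvC dotvDr !(dotvC w). Qed.

Lemma dotvZl m a (u w : 'cV[R]_m) : dotv (a *: u) w = a * dotv u w.
Proof. by rewrite dotvC dotvZr (dotvC w). Qed.

Lemma dotvNl m (u w : 'cV[R]_m) : dotv (- u) w = - dotv u w.
Proof. by rewrite dotvC dotvNr (dotvC w). Qed.

Lemma dotv_mulmxl m n (A : 'M[R]_(m, n)) u w :
  dotv (A *m u) w = dotv u (A^T *m w).
Proof. by rewrite /dotv trmx_mul mulmxA. Qed.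

Lemma fro_norm_ge0 m n (A : 'M[R]_(m, n)) : 0 <= fro_norm A.
Proof. exact: sqrtr_ge0. Qed.

Lemma fro_norm_sqr m n (A : 'M[R]_(m, n)) :
  fro_norm A ^+ 2 = \sum_i \sum_j A i j ^+ 2.
Proof.
by rewrite sqr_sqrtr// sumr_ge0// => i _; rewrite sumr_ge0// => j _; exact: sqr_ge0.
Qed.

Lemma dotvv m (u : 'cV[R]_m) : dotv u u = fro_norm u ^+ 2.
Proof.
by rewrite fro_norm_sqr dotvE; apply: eq_bigr => i _; rewrite big_ord1 expr2.
Qed.

Lemma dotvv_ge0 m (u : 'cV[R]_m) : 0 <= dotv u u.
Proof. by rewrite dotvv exprn_ge0// fro_norm_ge0. Qed.

Lemma dotvv_eq0 m (u : 'cV[R]_m) : dotv u u = 0 -> u = 0.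
Proof.
rewrite dotvE => /eqP; rewrite psumr_eq0 => [/allP u0|i _]; last first.
  by rewrite -expr2 sqr_ge0.
apply/matrixP => i j; rewrite ord1 mxE; apply/eqP.
by have := u0 i (mem_index_enum _); rewrite /= mulf_eq0 orbb.
Qed.

Lemma fro_norm_eq0 m (u : 'cV[R]_m) : fro_norm u = 0 -> u = 0.
Proof. by move=> u0; apply: dotvv_eq0; rewrite dotvv u0 expr0n. Qed.

Lemma fro_norm0 m n : fro_norm (0 : 'M[R]_(m, n)) = 0.
Proof.
apply/eqP; rewrite -sqrf_eq0 fro_norm_sqr big1// => i _.
by rewrite big1// => j _; rewrite mxE expr0n.
Qed.

Lemma fro_normZ m a (u : 'cV[R]_m) : 0 <= a -> fro_norm (a *: u) = a * fro_norm u.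
Proof.
move=> a0; apply/(@pexpIrn _ 2) => //; rewrite ?nnegrE ?mulr_ge0 ?fro_norm_ge0//.
by rewrite exprMn -!dotvv dotvZl dotvZr; ring.
Qed.

(** Comparisons between norms are made on their squares, which are dot
    products. *)
Lemma fro_norm_le_sqr m n p q (A : 'M[R]_(m, n)) (B : 'M[R]_(p, q)) c :
  0 <= c -> fro_norm A ^+ 2 <= c ^+ 2 * fro_norm B ^+ 2 ->
  fro_norm A <= c * fro_norm B.
Proof.
by move=> c0; rewrite -exprMn ler_pXn2r// nnegrE ?mulr_ge0 ?fro_norm_ge0.
Qed.

Lemma dotv_cauchy_schwarz m (u w : 'cV[R]_m) :
  dotv u w ^+ 2 <= dotv u u * dotv w w.
Proof.
have [w0|w0] := eqVneq (dotv w w) 0.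
  by rewrite (dotvv_eq0 w0) !dotv0r expr0n mulr0.
have wp : 0 < dotv w w by rewrite lt_neqAle eq_sym w0 dotvv_ge0.
have := dotvv_ge0 (dotv w w *: u - dotv u w *: w).
rewrite !(dotvDl, dotvDr, dotvNl, dotvNr, dotvZl, dotvZr) (dotvC w u) => h.
by rewrite -subr_ge0 -(pmulr_rge0 _ wp); apply: le_trans h _; lra.
Qed.

(** Cauchy-Schwarz applied to each row of [A]. *)
Lemma fro_norm_mulmx m n (A : 'M[R]_(m, n)) (u : 'cV_n) :
  fro_norm (A *m u) <= fro_norm A * fro_norm u.
Proof.
apply: fro_norm_le_sqr; first exact: fro_norm_ge0.
rewrite -dotvv dotvE (fro_norm_sqr A) mulr_suml ler_sum// => i _.
have -> : (A *m u) i 0 = dotv (row i A)^T u.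
  by rewrite dotvE mxE; apply: eq_bigr => j _; rewrite !mxE.
rewrite -expr2; apply: le_trans (dotv_cauchy_schwarz _ _) _.
rewrite [X in X * _ <= _]dotvE -dotvv ler_wpM2r ?dotvv_ge0//.
by rewrite ler_sum// => j _; rewrite !mxE expr2.
Qed.

Let spec_set m n (A : 'M[R]_(m, n)) :=
  [set fro_norm (A *m u) | u in [set u : 'cV[R]_n | fro_norm u <= 1]].

Let spec_set0 m n (A : 'M[R]_(m, n)) : spec_set A 0.
Proof. by exists 0; rewrite ?mulmx0/= fro_norm0. Qed.

Let spec_set_ub m n (A : 'M[R]_(m, n)) : has_ubound (spec_set A).
Proof.
exists (fro_norm A) => _ [u u1 <-]; apply: le_trans (fro_norm_mulmx _ _) _.
by rewrite ler_piMr// fro_norm_ge0.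
Qed.

Lemma spec_norm_ge0 m n (A : 'M[R]_(m, n)) : 0 <= spec_norm A.
Proof. exact: ub_le_sup (spec_set_ub A) _ (spec_set0 A). Qed.

Lemma fro_norm_mulmx_spec m n (A : 'M[R]_(m, n)) (u : 'cV_n) :
  fro_norm (A *m u) <= spec_norm A * fro_norm u.
Proof.
have [/fro_norm_eq0 ->|u0] := eqVneq (fro_norm u) 0.
  by rewrite mulmx0 !fro_norm0 mulr0.
have up : 0 < fro_norm u by rewrite lt_neqAle eq_sym u0 fro_norm_ge0.
rewrite -ler_pdivrMr// mulrC -fro_normZ ?invr_ge0 ?fro_norm_ge0// scalemxAr.
apply: ub_le_sup (spec_set_ub A) _ _; exists ((fro_norm u)^-1 *: u) => //=.
by rewrite fro_normZ ?invr_ge0 ?fro_norm_ge0// mulVf.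
Qed.

Lemma spec_norm_le m n (A : 'M[R]_(m, n)) c : 0 <= c ->
  (forall u : 'cV_n, fro_norm (A *m u) <= c * fro_norm u) -> spec_norm A <= c.
Proof.
move=> c0 Ac; apply: ge_sup; first by exists 0; exact: spec_set0.
by move=> _ [u u1 <-]; apply: le_trans (Ac u) _; rewrite ler_piMr.
Qed.

Lemma spec_norm_le_fro m n (A : 'M[R]_(m, n)) : spec_norm A <= fro_norm A.
Proof.
by apply: spec_norm_le => [|u]; [exact: fro_norm_ge0 | exact: fro_norm_mulmx].
Qed.

(** [|A|_Fro^2] is the sum over the [n] columns of their squared norms, and a
    column is the image under [A] of a unit vector. *)
Lemma fro_norm_le_spec m n (A : 'M[R]_(m, n)) :
  fro_norm A <= Num.sqrt n%:R * spec_norm A.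
Proof.
have nn : 0 <= Num.sqrt n%:R * spec_norm A.
  by rewrite mulr_ge0 ?sqrtr_ge0 ?spec_norm_ge0.
rewrite -(@ler_pXn2r _ 2)// ?nnegrE ?fro_norm_ge0// exprMn.
rewrite fro_norm_sqr sqr_sqrtr ?ler0n// exchange_big/=.
rewrite -[n in n%:R * _]card_ord mulr_natl -sumr_const ler_sum// => j _.
have -> : \sum_i A i j ^+ 2 = fro_norm (A *m delta_mx j (0 : 'I_1)) ^+ 2.
  by rewrite -colE -dotvv dotvE; apply: eq_bigr => i _; rewrite !mxE expr2.
rewrite ler_pXn2r// ?nnegrE ?fro_norm_ge0 ?spec_norm_ge0//.
have <- : spec_norm A * fro_norm (delta_mx j (0 : 'I_1)) = spec_norm A.
  apply/eqP; rewrite -subr_eq0 -[X in _ - X]mulr1 -mulrBr mulf_eq0 subr_eq0.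
  apply/orP; right; rewrite -(@eqrXn2 _ 2)// ?fro_norm_ge0// expr1n -dotvv.
  rewrite dotvE (bigD1 j)//= big1 => [|i ij]; rewrite !mxE ?eqxx ?mulr1 ?addr0//.
  by rewrite (negPf ij) mul0r.
exact: fro_norm_mulmx_spec.
Qed.

(** * Positive semidefinite matrices *)

Definition psd m (A : 'M[R]_m) : Prop :=
  A^T = A /\ forall u : 'cV_m, 0 <= dotv u (A *m u).

(** The form [u^T A u] is nonnegative at [s u - A u] for every [s]; bounding its
    term [(A u)^T A (A u)] by [c |A u|^2] and taking [s = c] gives the
    claim multiplied by [c].  If [c = 0], the choice [s = 1] gives [A u = 0]. *)
Lemma psd_fro_norm_mulmx m (A : 'M[R]_m) c : psd A -> 0 <= c ->
  (forall u : 'cV_m, dotv u (A *m u) <= c * dotv u u) ->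
  forall u : 'cV_m, fro_norm (A *m u) ^+ 2 <= c * dotv u (A *m u).
Proof.
move=> [symA posA] c0 Ac u; rewrite -dotvv; set w := A *m u.
have expand s : 0 <= s ^+ 2 * dotv u w - 2 * s * dotv w w + c * dotv w w.
  apply: le_trans (posA (s *: u - w)) _; apply: le_trans (lerD (lexx _) (Ac w)).
  rewrite mulmxDr mulmxN -scalemxAr -/w.
  rewrite !(dotvDl, dotvDr, dotvNl, dotvNr, dotvZl, dotvZr).
  have -> : dotv u (A *m w) = dotv w w by rewrite {2}/w dotv_mulmxl symA.
  lra.
have [c00|cN0] := eqVneq c 0.
  have := expand 1; have := Ac u; rewrite -/w c00 !mul0r; lra.
have cp : 0 < c by rewrite lt_neqAle eq_sym cN0.
rewrite -subr_ge0 -(pmulr_rge0 _ cp); apply: le_trans (expand c) _; lra.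
Qed.

(** Cauchy-Schwarz for [u] and [A u]. *)
Lemma quad_le_spec_norm m (A : 'M[R]_m) (u : 'cV_m) :
  dotv u (A *m u) <= spec_norm A * dotv u u.
Proof.
apply: le_trans (ler_norm _) _.
rewrite -(@ler_pXn2r _ 2)// ?nnegrE ?normr_ge0 ?mulr_ge0 ?spec_norm_ge0 ?dotvv_ge0//.
rewrite real_normK ?num_real//; apply: le_trans (dotv_cauchy_schwarz _ _) _.
have Au : dotv (A *m u) (A *m u) <= spec_norm A ^+ 2 * dotv u u.
  rewrite !dotvv -exprMn ler_pXn2r ?nnegrE ?mulr_ge0 ?spec_norm_ge0 ?fro_norm_ge0//.
  exact: fro_norm_mulmx_spec.
by apply: le_trans (ler_wpM2l (dotvv_ge0 u) Au) _; rewrite exprMn; lra.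
Qed.

Lemma psd_spec_norm_le m (A : 'M[R]_m) c : psd A -> 0 <= c ->
  (forall u : 'cV_m, dotv u (A *m u) <= c * dotv u u) -> spec_norm A <= c.
Proof.
move=> psdA c0 Ac; apply: spec_norm_le => // u; apply: fro_norm_le_sqr => //.
apply: le_trans (psd_fro_norm_mulmx psdA c0 Ac u) _.
by rewrite expr2 -mulrA ler_wpM2l// -dotvv.
Qed.

(** The vector is found in the kernel of [B = l I - A], where [l = |A|_2]: [B] is
    positive semidefinite, and an invertible positive semidefinite matrix is
    bounded below by a positive multiple of the identity, which would
    contradict that [l] is the spectral norm of [A]. *)
Lemma psd_spec_norm_attained m (A : 'M[R]_m) : (0 < m)%N -> psd A ->
  exists2 u : 'cV_m, u != 0 & dotv u (A *m u) = spec_norm A * dotv u u.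
Proof.
move=> m0 psdA; have [symA posA] := psdA.
pose l := spec_norm A; pose B := l%:M - A.
have BE (u : 'cV_m) : dotv u (B *m u) = l * dotv u u - dotv u (A *m u).
  by rewrite mulmxBl mul_scalar_mx dotvDr dotvNr dotvZr.
have symB : B^T = B by rewrite /B linearB/= tr_scalar_mx symA.
have psdB : psd B.
  by split=> // u; rewrite BE subr_ge0; exact: quad_le_spec_norm.
have [|detB] := boolP (\det B == 0).
  move/det0P => [v v0 vB]; exists v^T.
    by apply: contra v0 => /eqP v0; rewrite -[v]trmxK v0 trmx0.
  apply/eqP; rewrite eq_sym -subr_eq0 -BE.
  by rewrite -[B]symB -trmx_mul vB trmx0 /dotv mulmx0 mxE.
have Bunit : B \in unitmx by rewrite unitmxE unitfE.
exfalso.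
(* The summand 1 only ensures K > 0. *)
pose K := fro_norm (invmx B) ^+ 2 * spec_norm B + 1.
have K1 : 1 <= K.
  by rewrite lerDr mulr_ge0 ?exprn_ge0 ?fro_norm_ge0 ?spec_norm_ge0.
have K0 : 0 < K by exact: lt_le_trans ltr01 K1.
have lower (u : 'cV_m) : dotv u u <= K * dotv u (B *m u).
  have {1 2}-> : u = invmx B *m (B *m u) by rewrite mulKmx.
  rewrite dotvv; apply: le_trans (_ : (fro_norm (invmx B) * fro_norm (B *m u)) ^+ 2 <= _).
    by rewrite ler_pXn2r ?nnegrE ?mulr_ge0 ?fro_norm_ge0 ?fro_norm_mulmx.
  have h := psd_fro_norm_mulmx psdB (spec_norm_ge0 B) (@quad_le_spec_norm _ B) u.
  rewrite exprMn; apply: le_trans (ler_wpM2l (exprn_ge0 2 (fro_norm_ge0 _)) h) _.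
  by rewrite mulrA ler_wpM2r ?lerDl//; case: psdB.
have upper (u : 'cV_m) : dotv u (A *m u) <= (l - K^-1) * dotv u u.
  have := lower u; rewrite BE mulrC -ler_pdivrMr// mulrC; lra.
have lK : 0 <= l - K^-1.
  (* Any nonzero vector serves here; one exists since 0 < m. *)
  pose e : 'cV[R]_m := const_mx 1.
  have e0 : 0 < dotv e e.
    rewrite dotvE; under eq_bigr do rewrite !mxE mulr1.
    by rewrite sumr_const card_ord ltr0n.
  by rewrite -(pmulr_lge0 _ e0); exact: le_trans (posA e) (upper e).
have := psd_spec_norm_le psdA lK upper; rewrite -/l leNgt => /negP; apply.
by rewrite ltrBlDr ltrDl invr_gt0.
Qed.

End EuclideanSpace.

(** * Orthogonal projection onto a span *)

Section OrthogonalProjection.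
Variables (R : realType) (X : Type) (V : rkhs R X).
Implicit Types u v w : V.

Lemma innerC v w : inner V v w = inner V w v.
Proof. by rewrite hermC /= expr0 mul1r. Qed.

Lemma innerZl a v w : inner V (a *: v) w = a * inner V v w.
Proof. by rewrite linearZl_LR. Qed.

Lemma innerZr a v w : inner V v (a *: w) = a * inner V v w.
Proof. by rewrite innerC innerZl innerC. Qed.

Lemma inner_eq0 v : inner V v v = 0 -> v = 0.
Proof. by move/eqP; rewrite -normr_inner sqrf_eq0 normr_eq0 => /eqP. Qed.

Lemma inner_span_eq0 m (u : 'I_m -> V) v : (forall j, inner V v (u j) = 0) ->
  forall w, lin_span u w -> inner V v w = 0.
Proof.
move=> v0 _ [c _ <-]; rewrite linear_sumr/= big1// => i _.
by rewrite innerZr v0 mulr0.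
Qed.

Lemma lin_span_comb m (u : 'I_m -> V) a v w :
  lin_span u v -> lin_span u w -> lin_span u (a *: v + w).
Proof.
move=> [c _ <-] [e _ <-]; exists (fun i => a * c i + e i) => //.
rewrite scaler_sumr -big_split/=; apply: eq_bigr => i _.
by rewrite scalerDl scalerA.
Qed.

Lemma mem_lin_span m (u : 'I_m -> V) k : lin_span u (u k).
Proof.
exists (fun i => (i == k)%:R) => //.
by rewrite (bigD1 k)//= eqxx scale1r big1 ?addr0// => i /negPf ->; rewrite scale0r.
Qed.

Lemma lin_span0 m (u : 'I_m -> V) : lin_span u 0.
Proof. by exists (fun=> 0) => //; rewrite big1// => i _; rewrite scale0r. Qed.

(** One step of Gram-Schmidt at each stage of the induction: [r] is the part of
    the last vector orthogonal to the span of the others, and the projection of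
    [v] gains the component of [v] along [r].  If [r = 0], then [t = 0] because
    division by zero gives zero, so that linearly dependent families need no
    separate treatment. *)
Lemma orth_decomposition m (u : 'I_m -> V) v :
  exists2 w, lin_span u w & forall j, inner V (v - w) (u j) = 0.
Proof.
elim: m => [|m IH] in u v *; first by exists 0; [exact: lin_span0 | case].
have widen w : lin_span (fun i => u (lift ord_max i)) w -> lin_span u w.
  move=> [c _ <-]; exists (fun i => oapp c 0 (unlift ord_max i)) => //.
  rewrite (bigD1_ord ord_max)//= unlift_none/= scale0r add0r.
  by apply: eq_bigr => i _; rewrite liftK.
have [p up p_orth] := IH (fun i => u (lift ord_max i)) (u ord_max).
have [w uw w_orth] := IH (fun i => u (lift ord_max i)) v.
pose r := u ord_max - p.
have ur : lin_span u r.
  rewrite /r addrC -scaleN1r; apply: lin_span_comb (widen _ up) _.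
  exact: mem_lin_span.
pose t := inner V v r / inner V r r.
have tr : t * inner V r r = inner V v r.
  have [r0|r0] := eqVneq (inner V r r) 0; last by rewrite /t divfK.
  by rewrite r0 mulr0 (inner_eq0 r0) linear0r.
have orthS s z : lin_span (fun i => u (lift ord_max i)) z ->
    inner V (v - (s *: r + w)) z = 0.
  apply: inner_span_eq0 => j.
  by rewrite opprD addrCA linearDl/= w_orth addr0 linearNl/= innerZl p_orth mulr0 oppr0.
exists (t *: r + w); first exact: lin_span_comb ur (widen _ uw).
move=> j; have [k ->|->] := unliftP ord_max j.
  exact/orthS/(mem_lin_span (fun i => u (lift ord_max i)) k).
rewrite -[u ord_max](subrK p) -/r linearDr/= (orthS t p up) addr0.
rewrite linearBl/= linearDl/= innerZl tr innerC (innerC w).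
by rewrite [inner V r w](inner_span_eq0 p_orth uw) addr0 innerC subrr.
Qed.

Section Span.
Variables (m : nat) (u : 'I_m -> V).
Let P := orth_proj (lin_span u).

Lemma orth_projP v :
  lin_span u (P v) /\ forall w, lin_span u w -> inner V (v - P v) w = 0.
Proof.
have [w uw w_orth] := orth_decomposition u v.
apply: (@xgetPex _ 0 [set w | lin_span u w /\
  forall z, lin_span u z -> inner V (v - w) z = 0]).
by exists w; split=> //; exact: inner_span_eq0.
Qed.

(** Both sides lie in the span, and their difference is orthogonal to it. *)
Lemma orth_projZD a v w : P (a *: v + w) = a *: P v + P w.
Proof.
have [uv ov] := orth_projP v; have [uw ow] := orth_projP w.
have [us os] := orth_projP (a *: v + w).
pose z := P (a *: v + w) - (a *: P v + P w).
have uz : lin_span u z.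
  by rewrite /z addrC -scaleN1r; apply: lin_span_comb us; exact: lin_span_comb.
apply/eqP; rewrite -subr_eq0; apply/eqP/inner_eq0; rewrite -/z {1}/z.
have -> : P (a *: v + w) - (a *: P v + P w) =
    a *: (v - P v) + (w - P w) - (a *: v + w - P (a *: v + w)).
  by rewrite scalerBr addrACA -opprD opprB [RHS]addrC addrA subrK.
by rewrite linearBl/= linearDl/= innerZl ov// ow// os// mulr0 addr0 subrr.
Qed.

Lemma orth_proj_sum I (r : seq I) (c : I -> R) (f : I -> V) :
  P (\sum_(i <- r) c i *: f i) = \sum_(i <- r) c i *: P (f i).
Proof.
have P0 : P 0 = 0 by have := orth_projZD (-1) 0 0; rewrite scaleN1r addr0 oppr0 scaleN1r addNr.
by elim/big_rec2: _ => // i y z _ <-; exact: orth_projZD.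
Qed.

Lemma inner_orth_proj v w : inner V (P v) w = inner V (P v) (P w).
Proof.
have [uv _] := orth_projP v; have [_ ow] := orth_projP w.
by apply/eqP; rewrite -subr_eq0 -linearBr/= innerC ow.
Qed.

Lemma norm_sub_orth_proj v :
  `|v - P v| ^+ 2 = `|v| ^+ 2 - `|P v| ^+ 2.
Proof.
have [uv ov] := orth_projP v.
by rewrite normr_inner linearBr/= (ov _ uv) subr0 linearBl/= inner_orth_proj -!normr_inner.
Qed.

End Span.

End OrthogonalProjection.

(** * The Gram matrix of the projected inner product *)

Section Gram.
Variables (R : realType) (X : Type) (V : rkhs R X) (d : nat) (b : 'I_d -> V).
Variables (n : nat) (x : 'I_n -> X).
Let G := gram b x.

Definition lincomb (c : 'cV[R]_d) : V := \sum_i c i 0 *: b i.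

Lemma norm_x_lincomb (c : 'cV[R]_d) : norm_x x (lincomb c) ^+ 2 = dotv c (G *m c).
Proof.
rewrite normr_inner -inner_orth_proj orth_proj_sum linear_sumlz/= dotvE.
apply: eq_bigr => i _; rewrite innerZl mxE linear_sumr/=; congr (_ * _).
by apply: eq_bigr => j _; rewrite innerZr mxE mulrC.
Qed.

Lemma gram_sym : G^T = G.
Proof.
apply/matrixP => i j; rewrite !mxE /inner_x inner_orth_proj innerC.
by rewrite -inner_orth_proj.
Qed.

Hypothesis b_orthonormal : forall i j, inner V (b i) (b j) = (i == j)%:R.

Lemma norm_lincomb (c : 'cV[R]_d) : `|lincomb c| ^+ 2 = dotv c c.
Proof.
rewrite normr_inner linear_sumlz/= dotvE; apply: eq_bigr => i _.
rewrite innerZl linear_sumr/= (bigD1 i)//= innerZr b_orthonormal eqxx mulr1.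
rewrite big1 ?addr0// => j ji.
by rewrite innerZr b_orthonormal eq_sym (negPf ji) mulr0.
Qed.

Lemma dotv_sub_gram (c : 'cV[R]_d) :
  dotv c ((1%:M - G) *m c) = `|lincomb c| ^+ 2 - norm_x x (lincomb c) ^+ 2.
Proof.
by rewrite mulmxBl mul1mx dotvDr dotvNr norm_lincomb norm_x_lincomb.
Qed.

Lemma psd_sub_gram : psd (1%:M - G).
Proof.
split=> [|c]; first by rewrite linearB/= trmx1 gram_sym.
by rewrite dotv_sub_gram -norm_sub_orth_proj exprn_ge0.
Qed.

Lemma spec_norm_sub_gram_le1 : spec_norm (1%:M - G) <= 1.
Proof.
apply: (psd_spec_norm_le psd_sub_gram) => // c.
by rewrite dotv_sub_gram norm_lincomb mul1r gerBl exprn_ge0// normr_ge0.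
Qed.

End Gram.

(** * The constant mu *)

Lemma max_setE (R : realType) (S : set (\bar R)) (m : \bar R) :
  S m -> ubound S m -> max_set S = m.
Proof.
move=> Sm ubm; apply: xget_unique => [//|y [Sy uby]].
by apply/le_anti; rewrite ubm// uby.
Qed.

(** The ratio [|v| / |P v|] is largest at the vector whose coordinates maximize
    the Rayleigh quotient of [I - G].  If [|I - G|_2 = 1], this vector is
    orthogonal to [Vx], and the maximum is infinite. *)
Lemma mu_orthonormal_basis (R : realType) (X : Type) (V : rkhs R X)
    (d : nat) (d_gt0 : (0 < d)%N) (b : 'I_d -> V) (n : nat) (x : 'I_n -> X) :
  (forall i j, inner V (b i) (b j) = (i == j)%:R) ->
  (mu (lin_span b) x =
   (Num.sqrt (1 - spec_norm (1%:M - gram b x)))%:E^-1)%E.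
Proof.
move=> b_on; set l := spec_norm _.
have s0 : 0 <= 1 - l by rewrite subr_ge0; exact: spec_norm_sub_gram_le1 b_on.
apply: max_setE.
  have [c c0 cE] := psd_spec_norm_attained d_gt0 (psd_sub_gram x b_on).
  have v0 : 0 < `|lincomb b c|.
    rewrite lt_neqAle normr_ge0 andbT eq_sym; apply: contra c0 => /eqP v0.
    by apply/eqP/dotvv_eq0; rewrite -(norm_lincomb b_on) v0 expr0n.
  exists (lincomb b c).
    split; first by exists (fun i => c i 0).
    by rewrite -normr_gt0.
  have -> : norm_x x (lincomb b c) = Num.sqrt (1 - l) * `|lincomb b c|.
    apply/(@pexpIrn _ 2) => //; rewrite ?nnegrE ?mulr_ge0 ?sqrtr_ge0 ?normr_ge0//.
    move: cE; rewrite exprMn sqr_sqrtr// (dotv_sub_gram x b_on).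
    rewrite -(norm_lincomb b_on) -/l; lra.
  have [->|sN0] := eqVneq (Num.sqrt (1 - l)) 0.
    by rewrite mul0r inve0 gt0_muley ?lte_fin.
  rewrite !inver (negPf sN0) mulf_eq0 (negPf sN0) (gt_eqF v0)/= -EFinM.
  by rewrite invfM mulrCA divff ?mulr1// gt_eqF.
move=> _ [_ [[c _ <-] v0] <-].
pose cv : 'cV[R]_d := \col_i c i.
have vE : \sum_i c i *: b i = lincomb b cv.
  by apply: eq_bigr => i _; rewrite mxE.
move: v0; rewrite vE => v0.
have [->|sN0] := eqVneq (Num.sqrt (1 - l)) 0; first by rewrite inve0 leey.
have sp : 0 < Num.sqrt (1 - l) by rewrite lt_neqAle eq_sym sN0 sqrtr_ge0.
have nx : Num.sqrt (1 - l) * `|lincomb b cv| <= norm_x x (lincomb b cv).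
  rewrite -(@ler_pXn2r _ 2)// ?nnegrE ?mulr_ge0 ?sqrtr_ge0 ?normr_ge0//.
  have := quad_le_spec_norm (1%:M - gram b x) cv.
  rewrite exprMn sqr_sqrtr// (dotv_sub_gram x b_on) -(norm_lincomb b_on) -/l.
  lra.
have np : 0 < norm_x x (lincomb b cv).
  by apply: lt_le_trans nx; rewrite mulr_gt0 ?normr_gt0.
rewrite !inver (gt_eqF np) (negPf sN0) -EFinM lee_fin.
by rewrite ler_pdivrMr// mulrC ler_pdivlMr// mulrC.
Qed.

Theorem lemma7 (R : realType) (X : Type) (V : rkhs R X)
    (d : nat) (d_gt0 : (0 < d)%N) (Vd : set V) (b : 'I_d -> V)
    (b_basis : orthonormal_basis b Vd) (n : nat) (x : 'I_n -> X) :
  (* (_)^-1 in \bar R satisfies 0^-1 = +oo and +oo^-1 = 0 *)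
  let m : \bar R := mu Vd x in
  [/\ (m = (Num.sqrt (1 - spec_norm (1%:M - gram b x)))%:E^-1)%E,
      (Order.min (2%:E * (1 - (m ^+ 2)^-1)) 1 <= (tau b x)%:E)%E
    & ((tau b x)%:E <=
       Order.min ((1 + Num.sqrt d%:R)%:E * (1 - (m ^+ 2)^-1)) 1)%E].
Proof.
have [b_on ->] := b_basis; set l := spec_norm _ => m.
have l0 : 0 <= l := spec_norm_ge0 _.
have s0 : 0 <= 1 - l by rewrite subr_ge0; exact: spec_norm_sub_gram_le1 b_on.
have mE : (m = (Num.sqrt (1 - l))%:E^-1)%E by exact: mu_orthonormal_basis.
have m2E : ((m ^+ 2)^-1 = (1 - l)%:E)%E.
  rewrite mE; have [s00|sN0] := eqVneq (Num.sqrt (1 - l)) 0.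
    by rewrite s00 inve0 -[1 - l]sqr_sqrtr// s00 expr0n.
  rewrite inver (negPf sN0) -EFin_expe inver expf_eq0/= invr_eq0 (negPf sN0).
  by rewrite exprVn invrK sqr_sqrtr.
have lE : (1 - (m ^+ 2)^-1 = l%:E)%E by rewrite m2E -EFinB subKr.
split=> //; rewrite lE -EFinM -EFin_min lee_fin /tau -/l.
- have := spec_norm_le_fro (1%:M - gram b x); rewrite -/l => lf.
  by rewrite le_min ge_min ge_min lexx orbT andbT; apply/orP; left; lra.
- have := fro_norm_le_spec (1%:M - gram b x); rewrite -/l => fl.
  by rewrite le_min ge_min ge_min lexx orbT andbT; apply/orP; left; lra.
Qed.
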